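(* Let $S\subseteq\{0,1\}^n$ be a cube-ideal set-system with connectivity at least $2$. Then the $2$-cover graph $G(S)$ is a comparability graph (of a preorder on $[n]$).
   Context: A set-system is a subset $S\subseteq\{0,1\}^n$ with convex hull $\mathrm{conv}(S)$. A GSC inequality is $\sum_{i\in I}x_i+\sum_{j\in J}(1-x_j)\geq1$ for disjoint $I,J\subseteq[n]$, using $|I|+|J|$ variables; capacity inequalities are $x_i\geq0$, $x_i\leq1$. $S$ is cube-ideal if $\mathrm{conv}(S)$ is the solution set of a finite family of capacity and GSC inequalities. The connectivity of $S$ is the minimum number of variables in a GSC inequality valid for $\mathrm{conv}(S)$ ($+\infty$ if $S=\{0,1\}^n$). The $2$-cover graph $G(S)$ is the graph on $[n]$ with an edge $\{i,j\}$ for each pair of distinct indices such that at least one of $x_i+(1-x_j)\geq1$, $(1-x_i)+x_j\geq1$, $x_i+x_j\geq1$, $(1-x_i)+(1-x_j)\geq1$ is valid for $\mathrm{conv}(S)$. A preorder on $[n]$ is a reflexive transitive binary relation; its comparability graph has vertex set $[n]$ and an edge between every two distinct comparable elements. *)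

(* Defs.v *)
From mathcomp Require Import all_boot all_order all_algebra.
From mathcomp Require Import boolp classical_sets constructive_ereal reals.

Set Implicit Arguments.
Unset Strict Implicit.
Unset Printing Implicit Defensive.

Import Order.TTheory GRing.Theory Num.Theory.

Local Open Scope ring_scope.

Notation cube n := {ffun 'I_n -> bool}.

Definition vertex (R : realType) (n : nat) (s : cube n) : 'rV[R]_n :=
  \row_i (s i)%:R.

Arguments vertex R {n} s.

Definition conv_hull (R : realType) (n : nat) (S : {set cube n}) : set 'rV[R]_n :=
  [set x | exists w : cube n -> R,
     [/\ forall s, s \in S -> 0 <= w s,
         \sum_(s in S) w s = 1
       & x = \sum_(s in S) w s *: vertex R s]]%classic.

Arguments conv_hull R {n} S _.

Definition valid (R : realType) (n : nat) (S : {set cube n})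
    (ineq : pred 'rV[R]_n) : Prop :=
  forall x, conv_hull R S x -> ineq x.

(* The pair (I, J) stands for the inequality
   sum_(i in I) x_i + sum_(j in J) (1 - x_j) >= 1.
   Both sets may be empty, giving the infeasible inequality 0 >= 1, so the
   empty set-system is cube-ideal and has connectivity 0. *)
Notation gsc n := {p : {set 'I_n} * {set 'I_n} | [disjoint p.1 & p.2]}.

Definition gsc_holds (R : realType) (n : nat) (g : gsc n) : pred 'rV[R]_n :=
  fun x => 1 <= \sum_(i in (val g).1) x ord0 i
                + \sum_(j in (val g).2) (1 - x ord0 j).

Definition gsc_nvars (n : nat) (g : gsc n) : nat :=
  (#|(val g).1| + #|(val g).2|)%N.

Inductive cube_ineq (n : nat) : Type :=
  | CapacityLower of 'I_n
  | CapacityUpper of 'I_n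
  | Gsc of gsc n.

Definition cube_ineq_holds (R : realType) (n : nat) (c : cube_ineq n) :
    pred 'rV[R]_n :=
  fun x => match c with
           | CapacityLower i => 0 <= x ord0 i
           | CapacityUpper i => x ord0 i <= 1
           | Gsc g => gsc_holds g x
           end.

Definition cube_ideal (R : realType) (n : nat) (S : {set cube n}) : Prop :=
  exists cs : seq (cube_ineq n),
    conv_hull R S = [set x | all (fun c => cube_ineq_holds c x) cs]%classic.

(* The minimum over no inequality is +oo; this happens exactly when S is the
   whole cube, since a missing vertex v is cut off by the GSC inequality with
   I = {i | v_i = 0} and J = {j | v_j = 1}. *)
Definition connectivity (R : realType) (n : nat) (S : {set cube n}) : \bar R :=
  \big[Order.min/+oo%E]_(g : gsc n | `[< valid S (gsc_holds (R := R) g) >])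
     ((gsc_nvars g)%:R)%:E.

Definition cover2_graph (R : realType) (n : nat) (S : {set cube n}) :
    rel 'I_n :=
  fun i j => (i != j) &&
    `[< [\/ valid S (fun x : 'rV[R]_n => 1 <= x ord0 i + (1 - x ord0 j)),
            valid S (fun x : 'rV[R]_n => 1 <= (1 - x ord0 i) + x ord0 j),
            valid S (fun x : 'rV[R]_n => 1 <= x ord0 i + x ord0 j)
          | valid S (fun x : 'rV[R]_n =>
              1 <= (1 - x ord0 i) + (1 - x ord0 j))] >].

Definition preorder (T : Type) (r : rel T) : Prop :=
  reflexive r /\ transitive r.

Definition comparability_graph (T : eqType) (r : rel T) : rel T :=
  fun x y => (x != y) && (r x y || r y x).

(* Main.v *)
(** The point [(1/2, ..., 1/2)] satisfies the capacity inequalities and every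
    GSC inequality on at least two variables, so cube-idealness and connectivity
    at least 2 put it in [conv(S)].  Every valid implication [l <= m] between
    two literals is tight there, hence tight at each point [s] of [S] that has
    positive weight in a convex combination giving that point: [l] and [m] are
    both true or both false at [s].  Up to contraposition, each edge of the
    2-cover graph is therefore an implication between literals true at [s], and
    implication between literals is a preorder. *)

From HB Require Import structures.
Require Import Defs.
From mathcomp Require Import all_boot all_order all_algebra.
From mathcomp Require Import boolp classical_sets constructive_ereal reals.
From mathcomp Require Import ring lra.

Set Implicit Arguments.
Unset Strict Implicit.
Unset Printing Implicit Defensive.

Import Order.TTheory GRing.Theory Num.Theory.

Local Open Scope ring_scope.

Lemma preorder_relpre (T U : Type) (f : T -> U) (r : rel U) :
  preorder r -> preorder (relpre f r).
Proof.
case=> r_refl r_trans.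
by split=> [x|]; [exact: r_refl | exact: relpre_trans].
Qed.

Definition affine (K : pzRingType) (V : lmodType K) (f : V -> K) : Prop :=
  scalar (fun x => f x - f 0).

Lemma affine_sum (K : pzRingType) (V : lmodType K) (f : V -> K)
    (I : finType) (P : pred I) (w : I -> K) (v : I -> V) :
  affine f -> \sum_(i | P i) w i = 1 ->
  f (\sum_(i | P i) w i *: v i) = \sum_(i | P i) w i * f (v i).
Proof.
move=> f_affine w_sum.
pose f_lin : {scalar V} :=
  HB.pack (fun x => f x - f 0) (GRing.isLinear.Build K V K *%R _ f_affine).
have := linear_sum f_lin (index_enum I) P (fun i => w i *: v i).
under [RHS]eq_bigr do rewrite scalarZ /= mulrBr.
by rewrite sumrB -mulr_suml w_sum mul1r => /addIr.
Qed.

Section ConvexHull.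
Variables (R : realType) (n : nat).
Implicit Types (S : {set cube n}) (s : cube n) (x : 'rV[R]_n).

Lemma vertex_conv_hull S s : s \in S -> conv_hull R S (vertex R s).
Proof.
move=> sS; exists (fun t => (t == s)%:R); split=> [t _||].
- exact: ler0n.
- by rewrite (bigD1 s) //= eqxx big1 ?addr0 // => t /andP[_ /negbTE->].
- rewrite (bigD1 s) //= eqxx scale1r big1 ?addr0 // => t /andP[_ /negbTE->].
  by rewrite scale0r.
Qed.

Lemma conv_hull_tight_vertex S x :
  conv_hull R S x ->
  exists2 s, s \in S &
    forall f g : 'rV[R]_n -> R, affine f -> affine g ->
      valid S (fun y => f y <= g y) -> f x = g x ->
      f (vertex R s) = g (vertex R s).
Proof.
move=> [w [w_ge0 w_sum ->]].
have [|s /andP[sS ws_gt0]] := psumr_neq0P w_ge0.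
  by apply/eqP; rewrite w_sum oner_neq0.
exists s => // f g f_affine g_affine le_fg.
rewrite !affine_sum // => /esym/eqP; rewrite -subr_eq0 -sumrB => /eqP gap_sum.
have gap_ge0 t : t \in S -> 0 <= w t * g (vertex R t) - w t * f (vertex R t).
  move=> tS; rewrite subr_ge0 ler_wpM2l ?w_ge0 //.
  exact/le_fg/vertex_conv_hull.
have /eqP := psumr_eq0P gap_ge0 gap_sum sS.
by rewrite -mulrBr mulf_eq0 (gt_eqF ws_gt0) subr_eq0 => /eqP.
Qed.

Lemma cube_ideal_conv_hull S x :
  cube_ideal R S ->
  (forall c, valid S (cube_ineq_holds (R := R) c) -> cube_ineq_holds c x) ->
  conv_hull R S x.
Proof.
move=> [cs csE] x_sat; rewrite csE.
apply/(all_tnthP (t := in_tuple cs)) => k; apply: x_sat => y.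
by rewrite csE => /(all_tnthP (t := in_tuple cs)).
Qed.

Lemma connectivity_le S (g : gsc n) :
  valid S (gsc_holds (R := R) g) ->
  (connectivity R S <= ((gsc_nvars g)%:R)%:E)%E.
Proof. by move=> gS; apply: bigmin_le_cond; apply/asboolP. Qed.

Definition half_point : 'rV[R]_n := const_mx 2^-1.

Lemma gsc_holds_half_point (g : gsc n) :
  gsc_holds g half_point = (2 <= gsc_nvars g)%N.
Proof.
rewrite /gsc_holds /gsc_nvars.
under eq_bigr do rewrite mxE.
under [X in _ + X]eq_bigr do rewrite mxE.
have -> : 1 - 2^-1 = 2^-1 :> R by lra.
rewrite !sumr_const -mulrnDr -[_ *+ (_ + _)]mulr_natl.
by rewrite ler_pdivlMr // mul1r ler_nat.
Qed.

Lemma half_point_conv_hull S :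
  cube_ideal R S -> (2%:E <= connectivity R S)%E -> conv_hull R S half_point.
Proof.
move=> ideal_S conn_S; apply: cube_ideal_conv_hull => // -[i|i|g] gS /=.
- by rewrite mxE; lra.
- by rewrite mxE; lra.
rewrite gsc_holds_half_point -(ler_nat R) -lee_fin.
exact: le_trans conn_S (connectivity_le gS).
Qed.

End ConvexHull.

Arguments half_point R n : clear implicits.

Section Literals.
Variables (R : realType) (n : nat).
Implicit Types (S : {set cube n}) (s : cube n) (l m : 'I_n * bool).

(* The pair (i, b) stands for the literal asserting that coordinate i is b. *)
Definition literal l (x : 'rV[R]_n) : R :=
  if l.2 then x ord0 l.1 else 1 - x ord0 l.1.

Lemma literal_negb i b x : literal (i, ~~ b) x = 1 - literal (i, b) x.
Proof. by case: b; rewrite /literal //= subKr. Qed.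

Lemma literal_vertex l s : literal l (vertex R s) = (s l.1 == l.2)%:R.
Proof.
case: l => i b; rewrite /literal mxE /=.
by case: b; case: (s i); rewrite ?subr0 ?subrr.
Qed.

Lemma literal_half_point l : literal l (half_point R n) = 2^-1.
Proof. by rewrite /literal mxE; case: l.2; lra. Qed.

Lemma affine_literal l : affine (literal l).
Proof. by move=> a x y; rewrite /literal; case: l.2; rewrite !mxE; ring. Qed.

Definition implies S : rel ('I_n * bool) :=
  fun l m => `[< valid S (fun x => literal l x <= literal m x) >].

Lemma implies_preorder S : preorder (implies S).
Proof.
split=> [l|m l k /asboolP lm /asboolP mk]; apply/asboolP => x xS //.
exact: le_trans (lm x xS) (mk x xS).
Qed.

Lemma implies_contra S i a j b :
  implies S (i, ~~ a) (j, ~~ b) = implies S (j, b) (i, a).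
Proof.
by apply/asbool_equiv_eq; split=> + x xS => /(_ x xS);
  rewrite !literal_negb lerD2l lerN2.
Qed.

Lemma half_point_implies_vertex S :
  conv_hull R S (half_point R n) ->
  exists2 s, s \in S &
    forall l m, implies S l m -> (s l.1 == l.2) = (s m.1 == m.2).
Proof.
move=> /conv_hull_tight_vertex[s sS tight]; exists s => // l m /asboolP lm.
have := tight _ _ (affine_literal l) (affine_literal m) lm.
rewrite !literal_half_point !literal_vertex => /(_ erefl)/eqP.
by rewrite eqr_nat; case: (s _ == _); case: (s _ == _).
Qed.

Lemma cover2_graphP S i j :
  reflect (i != j /\ exists a b, implies S (i, a) (j, b))
          (cover2_graph R S i j).
Proof.
apply: (iffP andP) => -[ij edge]; split=> //.
  case/asboolP: edge => clause;
    [ exists false, false | exists true, true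
    | exists false, true | exists true, false ];
    by apply/asboolP => x /clause; rewrite /literal /=; lra.
case: edge => -[] [[] /asboolP imp]; apply/asboolP;
  [ constructor 2 | constructor 4 | constructor 3 | constructor 1 ];
  by move=> x /imp; rewrite /literal /=; lra.
Qed.

End Literals.

Theorem theorem4p2 (R : realType) (n : nat) (S : {set cube n})
    (ideal_S : cube_ideal R S) (conn_S : (2%:E <= connectivity R S)%E) :
  exists r : rel 'I_n, preorder r /\ cover2_graph R S =2 comparability_graph r.
Proof.
have [s _ same_truth] :=
  half_point_implies_vertex (half_point_conv_hull ideal_S conn_S).
exists (relpre (fun i => (i, s i)) (implies R S)); split.
  exact/preorder_relpre/implies_preorder.
move=> i j; apply/cover2_graphP/andP => -[ij edge]; split=> //.
  apply/orP; case: edge => a [b /[dup] /same_truth /=].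
  have [<-|] := eqVneq (s i) a.
    by move=> /esym/eqP <-; left.
  rewrite negb_eqb => /addbP<- /esym/negbT; rewrite negb_eqb => /addbP<-.
  by rewrite implies_contra; right.
case/orP: edge => [ij_imp|ji_imp]; first by exists (s i), (s j).
by exists (~~ s i), (~~ s j); rewrite implies_contra.
Qed.
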